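(* No algorithm in class $B_2$ for two-dimensional online hypercube (square) packing can achieve a competitive ratio of less than $2.0954$.
   Context: Online square packing: items are axis-parallel squares with side length in $(0,1]$ arriving online; each must be irrevocably placed, non-overlapping and without rotation, into a unit square bin upon arrival; the goal is to minimize the number of used bins. The competitive ratio is the asymptotic performance ratio $\limsup_{n\to\infty}\sup_\sigma\{\mathcal{A}(\sigma)/OPT(\sigma): OPT(\sigma)=n\}$. Class $B_2$ consists of online algorithms that distinguish (possibly among other types) the disjoint side-length intervals $I_m=(1/3,y]$ for some $y\in(1/3,1/2]$ and $I_\lambda=(0,\lambda]$ for some $\lambda>0$, and satisfy: (1) there is a parameter $\alpha$ such that an $\alpha$-fraction of the items with side length in $I_m$ are packed 1 per bin (''red items'') and the rest are packed 4 per bin (''blue items''); (2) no bin that contains an item with side length in $I_\lambda$ contains an item of side length larger than $1/2$ or an item with side length in $I_m$; (3) items with side length in $I_m$ are initially packed one per bin, and at some regular intervals the algorithm fixes some of these items to be red and does not pack additional items of the same type with them (so that at most $3/4$ of the blue items in $I_m$ are smaller than the smallest red item in $I_m$). *)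

(* Defs.v *)
From HB Require Import structures.
From mathcomp Require Import all_boot all_order all_algebra.
From mathcomp Require Import all_classical all_reals all_analysis.

Set Implicit Arguments.
Unset Strict Implicit.
Unset Printing Implicit Defensive.

Import Order.TTheory GRing.Theory Num.Theory.

Local Open Scope classical_set_scope.
Local Open Scope ring_scope.

(* Bins are numbered by nat; [corner] is the lower-left corner of the item. *)
Record placement (R : realType) := Placement {
  bin : nat;
  corner : R * R }.

Section Packing.
Variable R : realType.
Implicit Types (sigma : seq R) (p : nat -> placement R).

Definition input sigma : bool := all (fun s => 0 < s <= 1) sigma.

Definition square (c : R * R) (s : R) : set (R * R) :=
  [set z | (c.1 <= z.1 <= c.1 + s) && (c.2 <= z.2 <= c.2 + s)].

Definition open_square (c : R * R) (s : R) : set (R * R) :=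
  [set z | (c.1 < z.1 < c.1 + s) && (c.2 < z.2 < c.2 + s)].

Definition packing sigma p : Prop :=
  (forall i, (i < size sigma)%N ->
     square (corner (p i)) sigma`_i `<=` square (0, 0) 1) /\
  (forall i j, (i < j < size sigma)%N -> bin (p i) = bin (p j) ->
     open_square (corner (p i)) sigma`_i `&`
     open_square (corner (p j)) sigma`_j = set0).

Definition bins_used sigma p : nat :=
  size (undup [seq bin (p i) | i <- iota 0 (size sigma)]).

Definition is_opt sigma (n : nat) : Prop :=
  (exists2 p, packing sigma p & bins_used sigma p = n) /\
  (forall p, packing sigma p -> (n <= bins_used sigma p)%N).

(* [alg sigma] is the placement of the last item of [sigma], chosen knowing
   [sigma] only; as the algorithm is deterministic, its earlier placements are
   determined by the prefixes of [sigma]. *)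
Definition run (alg : seq R -> placement R) sigma (i : nat) : placement R :=
  alg (take i.+1 sigma).

Record online_algorithm := OnlineAlgorithm {
  alg :> seq R -> placement R;
  algP : forall sigma, input sigma -> packing sigma (run alg sigma) }.

Definition cost (A : online_algorithm) sigma : nat :=
  bins_used sigma (run A sigma).

Definition competitive_ratio (A : online_algorithm) : \bar R :=
  limn_esup (fun n : nat =>
    ereal_sup [set ((cost A sigma)%:R / n%:R)%:E | sigma in
                 [set sigma | input sigma /\ is_opt sigma n]]).

End Packing.

Variant status := Provisional | Red | Blue.

Definition is_red (c : status) := if c is Red then true else false.
Definition is_blue (c : status) := if c is Blue then true else false.

Section ClassB2.
Variable R : realType.
Implicit Types (sigma tau : seq R) (s : R) (i j : nat).
Variable A : online_algorithm R.
Variables (y lambda alpha : R).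

(* [col sigma i] is the status of item [i] just after the last item of [sigma]
   has been packed; statuses are revised between this moment and the packing of
   the next item. Only the values on items of [I_m] matter. *)
Variable col : seq R -> nat -> status.

Definition medium s : bool := 3^-1 < s <= y.

Definition I_m : set R := [set s | medium s].
Definition I_lambda : set R := [set s | 0 < s <= lambda].

Definition bin_of sigma i : nat := bin (run A sigma i).

Definition count_items sigma (P : pred nat) : nat :=
  count P (iota 0 (size sigma)).

Definition num_medium sigma : nat := count_items sigma (fun i => medium sigma`_i).

Definition num_medium_in_bin sigma (b : nat) : nat :=
  count_items sigma (fun i => medium sigma`_i && (bin_of sigma i == b)).

Definition red_item sigma i : bool := medium sigma`_i && is_red (col sigma i).
Definition blue_item sigma i : bool := medium sigma`_i && is_blue (col sigma i).

Definition num_red_1_per_bin sigma : nat :=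
  count_items sigma (fun i =>
    red_item sigma i && (num_medium_in_bin sigma (bin_of sigma i) == 1%N)).

Definition num_blue_4_per_bin sigma : nat :=
  count_items sigma (fun i =>
    blue_item sigma i && (num_medium_in_bin sigma (bin_of sigma i) == 4%N)).

(* Proportions of the items of [I_m] are meant up to a sublinear number of
   items: at any time some bins are still incomplete and some items are still
   provisional, and [alpha] times the number of items need not be an integer. *)
Definition le_upto_o (P : seq R -> Prop) (f g : seq R -> R) : Prop :=
  forall eps : R, 0 < eps -> exists K : R, forall sigma, input sigma -> P sigma ->
    f sigma <= g sigma + eps * (num_medium sigma)%:R + K.

Definition eq_upto_o (f g : seq R -> R) : Prop :=
  le_upto_o (fun=> True) f g /\ le_upto_o (fun=> True) g f.

Definition B2_fractions : Prop :=
  eq_upto_o (fun sigma => (num_red_1_per_bin sigma)%:R)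
            (fun sigma => alpha * (num_medium sigma)%:R) /\
  eq_upto_o (fun sigma => (num_blue_4_per_bin sigma)%:R)
            (fun sigma => (1 - alpha) * (num_medium sigma)%:R).

Definition B2_sand_separate : Prop :=
  forall sigma i j, input sigma -> (i < size sigma)%N -> (j < size sigma)%N ->
    bin_of sigma i = bin_of sigma j -> I_lambda sigma`_i ->
    ~ (2^-1 < sigma`_j) /\ ~ I_m sigma`_j.

Definition B2_initially_one_per_bin : Prop :=
  (forall sigma s, input (rcons sigma s) -> I_m s ->
     (forall i, (i < size sigma)%N -> I_m sigma`_i ->
        bin_of (rcons sigma s) i <> bin_of (rcons sigma s) (size sigma)) ->
     col (rcons sigma s) (size sigma) = Provisional) /\
  (forall sigma i, input sigma -> (i < size sigma)%N -> I_m sigma`_i ->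
     col sigma i = Provisional ->
     num_medium_in_bin sigma (bin_of sigma i) = 1%N).

Definition B2_fixed_forever : Prop :=
  forall sigma s i, input (rcons sigma s) -> (i < size sigma)%N ->
    I_m sigma`_i -> col sigma i <> Provisional ->
    col (rcons sigma s) i = col sigma i.

Definition B2_red_alone : Prop :=
  forall sigma i, input sigma -> (i < size sigma)%N -> red_item sigma i ->
    num_medium_in_bin sigma (bin_of sigma i) = 1%N.

(* Regular intervals: among any [k] consecutive arrivals of items of [I_m],
   the status of some provisional item gets fixed. *)
Definition B2_regular_intervals : Prop :=
  exists k : nat, forall sigma tau, input (sigma ++ tau) ->
    (k <= num_medium tau)%N ->
    exists i j, [/\ (j < size tau)%N, (i < size sigma + j)%N,
      I_m (sigma ++ tau)`_i,
      col (sigma ++ take j tau) i = Provisional &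
      col (sigma ++ take j.+1 tau) i <> Provisional].

Definition has_red sigma : bool := has (red_item sigma) (iota 0 (size sigma)).

Definition num_blue sigma : nat := count_items sigma (blue_item sigma).

Definition num_blue_below_red sigma : nat :=
  count_items sigma (fun i => blue_item sigma i &&
    all (fun j => red_item sigma j ==> (sigma`_i < sigma`_j))
        (iota 0 (size sigma))).

Definition B2_blue_below_red : Prop :=
  le_upto_o has_red (fun sigma => (num_blue_below_red sigma)%:R)
                    (fun sigma => 3 / 4 * (num_blue sigma)%:R).

Record class_B2_with : Prop := ClassB2With {
  B2_y : 3^-1 < y <= 2^-1;
  B2_lambda : 0 < lambda;
  B2_disjoint : I_m `&` I_lambda = set0;
  B2_alpha : 0 <= alpha <= 1;
  B2_cond1 : B2_fractions;
  B2_cond2 : B2_sand_separate;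
  B2_cond3_initial : B2_initially_one_per_bin;
  B2_cond3_fixed : B2_fixed_forever;
  B2_cond3_red : B2_red_alone;
  B2_cond3_regular : B2_regular_intervals;
  B2_cond3_blue : B2_blue_below_red }.

End ClassB2.

Definition class_B2 (R : realType) (A : online_algorithm R) : Prop :=
  exists (y lambda alpha : R) (col : seq R -> nat -> status),
    class_B2_with A y lambda alpha col.

(* Main.v *)
Require Import Defs.
From mathcomp Require Import all_boot all_order all_algebra.
From mathcomp Require Import all_classical all_reals all_analysis.
From mathcomp Require Import zify ring lra.
Set Implicit Arguments.
Unset Strict Implicit.
Unset Printing Implicit Defensive.
Import Order.TTheory GRing.Theory Num.Theory.
Local Open Scope ring_scope.

(* The adversary first sends N items of I_m just above 1/3, bisecting: an item
   that opens a bin is declared big and all later items are smaller, any other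
   item is declared small and all later items are larger. In the end some t
   separates the B items opening a bin from the N - B others, so that each bin
   with an item of I_m contains one of side > t. Two continuations are used,
   both ending with fine sand, which fills separate bins.
   - N/3 items of side just above 1/2: the optimum packs each with three items
     of I_m and 5/12 of sand, whereas they avoid the (1 - alpha) N/4 bins with
     four items of I_m. A ratio below 2.0954 forces alpha > 0.095.
   - (N - B)/3 items of side 1 - t: they fit with the small items, three per
     bin, leaving 2/9 for sand, but with no bin of the algorithm holding an item
     of I_m. The big items are packed by four, leaving 5/9 for sand. A ratio
     below 2.0954 forces B/N < 0.32123, but B >= (alpha + (1 - alpha)/4) N.
   Sand has side 1/K, K = 6q - 1. An item of side more than 1/g contains an
   interior point of the grid of mesh 1/g, hence at most (g - 1)^2 such items
   share a bin; this replaces all area arguments. *)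

(** * Counting bins *)

Section BinCount.
Local Open Scope nat_scope.
Implicit Types (f g : nat -> nat) (P Q : pred nat).

Definition bin_count f (n : nat) P : nat :=
  size (undup [seq f i | i <- iota 0 n & P i]).

Lemma mem_bin_count f n P b :
  reflect (exists i, [/\ i < n, P i & b = f i])
          (b \in undup [seq f i | i <- iota 0 n & P i]).
Proof.
rewrite mem_undup; apply: (iffP mapP) => [[i]|[i [ltin Pi ->]]].
  by rewrite mem_filter mem_iota => /andP[Pi ltin] ->; exists i.
by exists i; rewrite // mem_filter Pi mem_iota.
Qed.

Lemma bin_count_le f n P g m Q :
  (forall i, i < n -> P i -> exists j, [/\ j < m, Q j & f i = g j]) ->
  bin_count f n P <= bin_count g m Q.
Proof.
move=> sub; apply: uniq_leq_size (undup_uniq _) _ => b /mem_bin_count[i [ltin Pi ->]].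
by have [j [ltjm Qj eqf]] := sub i ltin Pi; apply/mem_bin_count; exists j.
Qed.

Lemma bin_count_disjoint f n P Q :
  (forall i j, i < n -> j < n -> P i -> Q j -> f i <> f j) ->
  bin_count f n P + bin_count f n Q <= bin_count f n (predU P Q).
Proof.
move=> dis; rewrite /bin_count -size_cat; apply: uniq_leq_size.
  rewrite cat_uniq !undup_uniq andbT /=; apply/hasPn => b.
  move=> /mem_bin_count[j [ltjn Qj ->]].
  by apply/mem_bin_count => -[i [ltin Pi /esym]]; apply: dis.
move=> b; rewrite mem_cat => /orP[] /mem_bin_count[i [ltin Pi ->]];
  by apply/mem_bin_count; exists i; rewrite /= Pi ?orbT.
Qed.

Lemma count_le_bin_count f n P k :
  (forall b, count (fun i => P i && (f i == b)) (iota 0 n) <= k) ->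
  count P (iota 0 n) <= k * bin_count f n P.
Proof.
move=> le_k; rewrite /bin_count.
(* The claim is generalised to any list [bs] containing all values met, because the induction
   removes one bin at a time and shrinks the predicate to the items outside it. *)
suff main bs s P' : (forall b, count (fun i => P' i && (f i == b)) s <= k) ->
    {in s, forall i, P' i -> f i \in bs} -> count P' s <= k * size bs.
  by apply: main => // i; rewrite mem_iota => ltin Pi; apply/mem_bin_count; exists i.
elim: bs P' => [|b bs IH] {}P {}le_k subU /=.
  by rewrite muln0 leqn0 eqn0Ngt -has_count; apply/hasPn => i /subU; case: (P i) => // /(_ isT).
rewrite mulnS.
have -> : count P s = count (fun i => P i && (f i == b)) s
                    + count (fun i => P i && (f i != b)) s.
  rewrite -size_filter -(count_predC (fun i => f i == b) [seq i <- s | P i]) !count_filter.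
  by congr (_ + _); apply: eq_count => i /=; rewrite andbC.
apply: leq_add (le_k b) _; apply: IH => [c|i si /andP[Pi neb]].
  apply: leq_trans (le_k c); apply: sub_count => i /andP[/andP[-> _] ->] //.
by have := subU i si Pi; rewrite inE (negPf neb).
Qed.

End BinCount.

(** * Geometry of packings *)

Section Geometry.
Variable R : realType.
Implicit Types (sigma : seq R) (p : nat -> placement R) (a b : (R * R) * R).

(** A square is encoded as its lower-left corner paired with its side. The test asks for a vertical
    or horizontal line between the two squares; common boundary points are allowed. *)
Definition separated a b : bool :=
  [|| a.1.1 + a.2 <= b.1.1, b.1.1 + b.2 <= a.1.1,
      a.1.2 + a.2 <= b.1.2 | b.1.2 + b.2 <= a.1.2].

Definition in_unit a : bool :=
  [&& 0 < a.2, 0 <= a.1.1, a.1.1 + a.2 <= 1, 0 <= a.1.2 & a.1.2 + a.2 <= 1].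

Lemma separatedC a b : separated a b = separated b a.
Proof. by rewrite /separated; do 4! case: (_ <= _). Qed.

Lemma separated_irrefl a : 0 < a.2 -> separated a a = false.
Proof. by move=> a_gt0; rewrite /separated !gerDl !leNgt a_gt0. Qed.

Lemma open_square_disjoint (c d : R * R) (s u : R) :
  separated (c, s) (d, u) -> (open_square c s `&` open_square d u = set0)%classic.
Proof.
move=> sep; rewrite -subset0 => z [/=].
rewrite /open_square /= => /andP[/andP[? ?] /andP[? ?]] /andP[/andP[? ?] /andP[? ?]].
by move: sep; rewrite /separated /= => /or4P[] ?; lra.
Qed.

Lemma open_square_meet (c d z : R * R) (s u : R) :
  (open_square c s `&` open_square d u = set0)%classic ->
  c.1 < z.1 < c.1 + s -> c.2 < z.2 < c.2 + s ->
  d.1 < z.1 < d.1 + u -> d.2 < z.2 < d.2 + u -> False.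
Proof.
move=> dis h1 h2 h3 h4; suff : (set0 : set (R * R)) z by [].
by rewrite -dis; split; rewrite /open_square /=; apply/andP.
Qed.

Lemma packing_in_unit sigma p i : packing sigma p -> (i < size sigma)%N ->
  0 < sigma`_i -> in_unit (corner (p i), sigma`_i).
Proof.
move=> [inu _] ltin s_gt0; have sq := inu i ltin; rewrite /in_unit s_gt0 /=.
(* Containment in the unit square is tested at two opposite corners only. *)
have := sq (corner (p i)); have := sq ((corner (p i)).1 + sigma`_i, (corner (p i)).2 + sigma`_i).
rewrite /square /= => h1 h2.
move: h1 => /(_ _)/andP[|/andP[? ?] /andP[? ?]]; first by apply/andP; split; lra.
move: h2 => /(_ _)/andP[|/andP[? ?] /andP[? ?]]; first by apply/andP; split; lra.
by apply/and4P; split; lra.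
Qed.

Lemma packing_disjoint sigma p i j : packing sigma p ->
  (i < size sigma)%N -> (j < size sigma)%N -> i <> j -> bin (p i) = bin (p j) ->
  (open_square (corner (p i)) sigma`_i `&` open_square (corner (p j)) sigma`_j
   = set0)%classic.
Proof.
move=> [_ dis] lti ltj neij eqb; have [ltij|ltji|//] := ltngtP i j.
  by apply: dis; rewrite ?ltij.
by rewrite setIC; apply: dis; rewrite ?ltji.
Qed.

(* An interval of length more than 1/g inside [0, 1] contains one of the points
   1/g, ..., (g-1)/g in its interior. *)
Definition grid_point (g : nat) (x : R) : nat := (Num.truncn (x * g%:R)).+1.

(** The index is the least integer above [x * g], hence at most [x * g + 1], which lies below
    [(x + s) * g] as soon as [s * g > 1]. *)
Lemma grid_pointP (g : nat) (x s : R) : (0 < g)%N -> 0 <= x -> x + s <= 1 ->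
  g%:R^-1 < s ->
  [/\ (0 < grid_point g x < g)%N & x < (grid_point g x)%:R / g%:R < x + s].
Proof.
move=> g_gt0 x_ge0 xs1 gs; have g0 : 0 < g%:R :> R by rewrite ltr0n.
have /truncn_itv /andP[le1 lt1] : 0 <= x * g%:R by apply: mulr_ge0 => //; apply: ltW.
have gs1 : 1 < s * g%:R by rewrite -ltr_pdivrMr // div1r.
have lt2 : (grid_point g x)%:R < (x + s) * g%:R by rewrite -natr1 mulrDl; lra.
split; last by rewrite ltr_pdivlMr // ltr_pdivrMr // lt1 lt2.
rewrite /= -(ltr_nat R); apply: lt_le_trans lt2 _.
by rewrite ger_pMl.
Qed.

(** Each item selects a grid point in its interior. Two items of one bin selecting the same point
    would overlap, so the selection injects the items into the interior points of the grid. *)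
Lemma card_bin_le sigma p (g b : nat) (I : seq nat) :
  packing sigma p -> (0 < g)%N -> uniq I ->
  {in I, forall i, [/\ (i < size sigma)%N, g%:R^-1 < sigma`_i & bin (p i) = b]} ->
  (size I <= g.-1 ^ 2)%N.
Proof.
move=> pk g_gt0 uI hI.
have g0 : 0 < g%:R^-1 :> R by rewrite invr_gt0 ltr0n.
pose h i := (grid_point g (corner (p i)).1, grid_point g (corner (p i)).2).
have hP i : i \in I -> [/\ (0 < (h i).1 < g)%N, (0 < (h i).2 < g)%N,
    (corner (p i)).1 < (h i).1%:R / g%:R < (corner (p i)).1 + sigma`_i &
    (corner (p i)).2 < (h i).2%:R / g%:R < (corner (p i)).2 + sigma`_i].
  move=> /hI[lti gi _].
  have /and5P[_ ? ? ? ?] := packing_in_unit pk lti (lt_trans g0 gi).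
  have [? ?] : [/\ (0 < (h i).1 < g)%N & (corner (p i)).1 < (h i).1%:R / g%:R < (corner (p i)).1 + sigma`_i] by exact: grid_pointP.
  have [? ?] : [/\ (0 < (h i).2 < g)%N & (corner (p i)).2 < (h i).2%:R / g%:R < (corner (p i)).2 + sigma`_i] by exact: grid_pointP.
  by split.
have injh : {in I &, injective h}.
  move=> i j iI jI eqh; apply/eqP/negPn/negP => /eqP neij.
  have [lti _ bi] := hI i iI; have [ltj _ bj] := hI j jI.
  have dis := packing_disjoint pk lti ltj neij (etrans bi (esym bj)).
  have [_ _ i1 i2] := hP i iI; have [_ _ j1 j2] := hP j jI.
  rewrite -eqh in j1 j2.
  exact: (@open_square_meet _ _ ((h i).1%:R / g%:R, (h i).2%:R / g%:R) _ _ dis).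
rewrite -(size_map h) -[leqRHS]/(_ * _)%N -{1}(size_iota 1 g.-1) -{2}(size_iota 1 g.-1).
rewrite -(size_allpairs (fun x y => (x, y))); apply: uniq_leq_size.
  by rewrite map_inj_in_uniq.
move=> _ /mapP[i iI ->]; have [h1 h2 _ _] := hP i iI.
rewrite [h i]surjective_pairing allpairs_f // mem_iota; lia.
Qed.

Lemma count_bin_le sigma p (g : nat) (P : pred nat) :
  packing sigma p -> (0 < g)%N ->
  (forall i, (i < size sigma)%N -> P i -> g%:R^-1 < sigma`_i) ->
  (count P (iota 0 (size sigma)) <=
   g.-1 ^ 2 * bin_count (fun i => bin (p i)) (size sigma) P)%N.
Proof.
move=> pk g_gt0 gP; apply: count_le_bin_count => b.
rewrite -size_filter; apply: (card_bin_le (b := b) pk g_gt0).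
  by rewrite filter_uniq ?iota_uniq.
move=> i; rewrite mem_filter mem_iota => /andP[/andP[Pi /eqP bi] lti].
by split=> //; apply: gP.
Qed.

(** In each coordinate, two intervals inside the unit interval with total length above 1 overlap;
    the two common coordinates give a point interior to both squares. *)
Lemma bin_neq_of_side sigma p i j : packing sigma p ->
  (i < size sigma)%N -> (j < size sigma)%N -> i <> j ->
  0 < sigma`_i -> 0 < sigma`_j -> 1 < sigma`_i + sigma`_j ->
  bin (p i) <> bin (p j).
Proof.
move=> pk lti ltj neij i_gt0 j_gt0 gt1 eqb.
have dis := packing_disjoint pk lti ltj neij eqb.
have /and5P[_ /= ? ? ? ?] := packing_in_unit pk lti i_gt0.
have /and5P[_ /= ? ? ? ?] := packing_in_unit pk ltj j_gt0.
have mid (x y s u : R) : 0 <= x -> x + s <= 1 -> 0 <= y -> y + u <= 1 -> 0 < s -> 0 < u ->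
    1 < s + u -> exists z, x < z < x + s /\ y < z < y + u.
  (* The midpoint between the larger left end and the smaller right end. *)
  move=> *; exists ((Num.max x y + Num.min (x + s) (y + u)) / 2).
  by rewrite /Num.max /Num.min; do 2 case: ifPn; rewrite -?leNgt => ? ?; split; apply/andP; split; lra.
have [z1 [? ?]] : exists z, (corner (p i)).1 < z < (corner (p i)).1 + sigma`_i /\
   (corner (p j)).1 < z < (corner (p j)).1 + sigma`_j by apply: mid.
have [z2 [? ?]] : exists z, (corner (p i)).2 < z < (corner (p i)).2 + sigma`_i /\
   (corner (p j)).2 < z < (corner (p j)).2 + sigma`_j by apply: mid.
exact: (@open_square_meet _ _ (z1, z2) _ _ dis).
Qed.

Lemma is_opt_exists sigma p : packing sigma p ->
  exists2 n, is_opt sigma n & (n <= bins_used sigma p)%N.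
Proof.
move=> pk; have ex : exists n, `[< exists2 p, packing sigma p & bins_used sigma p = n >].
  by exists (bins_used sigma p); apply/asboolP; exists p.
case: (ex_minnP ex) => n /asboolP hn min; exists n; last by apply: min; apply/asboolP; exists p.
by split=> // p' pk'; apply: min; apply/asboolP; exists p'.
Qed.

End Geometry.

(** * The bisecting adversary *)

Section Opening.
Local Open Scope nat_scope.

Definition opens (f : nat -> nat) (i : nat) : bool :=
  f i \notin [seq f j | j <- iota 0 i].

Lemma eq_opens f g i : (forall j, j <= i -> f j = g j) -> opens f i = opens g i.
Proof.
move=> eqfg; rewrite /opens eqfg //; congr (_ \notin _).
by apply/eq_in_map => j; rewrite mem_iota => /ltnW /eqfg.
Qed.

(** The witness is the first index with that value. It passes from an arbitrary item to the item
    that opened its bin. *)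
Lemma opens_exists f i : exists j, [/\ j <= i, opens f j & f j = f i].
Proof.
have ex : exists j, f j == f i by exists i.
case: (ex_minnP ex) => j /eqP eqf min; exists j; split=> //; first exact: min.
apply/mapP => -[k]; rewrite mem_iota => /andP[_ ltkj] eqk.
by have := min k; rewrite -eqk eqf eqxx => /(_ isT); rewrite leqNgt ltkj.
Qed.

Lemma count_opens f n : count (opens f) (iota 0 n) = bin_count f n predT.
Proof.
rewrite -size_filter -(size_map f) /bin_count filter_predT.
apply/perm_size/uniq_perm; rewrite ?undup_uniq //.
  elim: n => // n IH; rewrite -addn1 iotaD add0n filter_cat map_cat cat_uniq IH /=.
  case: ifP => [open_n|] //=; rewrite orbF andbT.
  by apply: contra open_n => /mapP[i]; rewrite mem_filter => /andP[_ ?] ->; apply: map_f.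
move=> b; rewrite mem_undup; apply/mapP/mapP => [[i]|[i]].
  by rewrite mem_filter => /andP[_ ?] ->; exists i.
rewrite mem_iota => /andP[_ ltin] ->; have [j [leji oj eqf]] := opens_exists f i.
by exists j; rewrite // mem_filter oj mem_iota /= add0n (leq_ltn_trans leji ltin).
Qed.

End Opening.

Section Adversary.
Variables (R : realType) (A : online_algorithm R).

Lemma bin_of_cat (sigma tau : seq R) i : (i < size sigma)%N ->
  bin_of A (sigma ++ tau) i = bin_of A sigma i.
Proof. by move=> lti; rewrite /bin_of /run takel_cat. Qed.

(** Invariant: big items lie at or above [hi], small ones at or below [lo]. The next item is the
    midpoint, and the algorithm's answer decides which half of the interval survives; the algorithm
    being online, earlier answers never change. *)
Lemma bisecting_adversary (lo0 hi0 : R) (N : nat) : lo0 < hi0 ->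
  exists sigma lo hi, [/\ size sigma = N, lo0 <= lo, lo < hi, hi <= hi0 &
    forall i, (i < N)%N -> lo0 < sigma`_i < hi0 /\
      if opens (bin_of A sigma) i then hi <= sigma`_i else sigma`_i <= lo].
Proof.
move=> lt0; elim: N => [|N [sigma [lo [hi [sz lelo ltlh lehi IH]]]]].
  by exists [::], lo0, hi0; split.
pose m := (lo + hi) / 2; pose tau := rcons sigma m.
have lom : lo < m by rewrite /m; lra.
have mhi : m < hi by rewrite /m; lra.
have eqo i : (i < N)%N -> opens (bin_of A tau) i = opens (bin_of A sigma) i.
  move=> lti; apply: eq_opens => j leji; rewrite /tau -cats1 bin_of_cat // sz.
  exact: leq_ltn_trans lti.
have tauN : tau`_N = m by rewrite nth_rcons sz ltnn eqxx.
have taui i : (i < N)%N -> tau`_i = sigma`_i by move=> lti; rewrite nth_rcons sz lti.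
case: (boolP (opens (bin_of A tau) N)) => oN.
  exists tau, lo, m; split; rewrite ?size_rcons ?sz //; first lra.
  move=> i; rewrite ltnS leq_eqVlt => /orP[/eqP -> |lti].
    by rewrite tauN oN lexx; split=> //; apply/andP; split; lra.
  have [? h] := IH i lti; rewrite taui // eqo //; split=> //.
  by case: ifP h => _ // ?; lra.
exists tau, m, hi; split; rewrite ?size_rcons ?sz //; first lra.
move=> i; rewrite ltnS leq_eqVlt => /orP[/eqP -> |lti].
  by rewrite tauN (negPf oN) lexx; split=> //; apply/andP; split; lra.
have [? h] := IH i lti; rewrite taui // eqo //; split=> //.
by case: ifP h => _ // ?; lra.
Qed.

End Adversary.

(** * Building good packings *)

Lemma count_iota_lt (P : pred nat) i j : P i -> (i < j)%N ->
  (count P (iota 0 i) < count P (iota 0 j))%N.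
Proof.
move=> Pi ltij; have -> : j = (i + 1 + (j - i.+1))%N by lia.
by rewrite !iotaD !count_cat /= add0n Pi; lia.
Qed.

(** An item receives the slot numbered by its rank among the items of its type. Equal types differ
    in rank, different types have disjoint lists, and ranks stay below the list size, so the default
    [x0] is never reached. *)
Lemma assignment_exists (K X : eqType) (x0 : X) (n : nat) (ty : nat -> K) (W : K -> seq X) :
  (forall k, (count (fun i => ty i == k) (iota 0 n) <= size (W k))%N) ->
  (forall k, uniq (W k)) ->
  (forall k k' x, x \in W k -> x \in W k' -> k = k') ->
  exists g : nat -> X, (forall i, (i < n)%N -> g i \in W (ty i)) /\
    (forall i j, (i < j < n)%N -> g i <> g j).
Proof.
move=> le_size uW disW.
pose rank i := count (fun j => ty j == ty i) (iota 0 i).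
have rank_lt i j : (i < j)%N -> ty i = ty j -> (rank i < rank j)%N.
  by move=> ltij eqt; rewrite /rank eqt; apply: count_iota_lt => //; apply/eqP.
have rankP i : (i < n)%N -> (rank i < size (W (ty i)))%N.
  move=> ltin; apply: leq_trans (le_size (ty i)).
  exact: count_iota_lt.
exists (fun i => nth x0 (W (ty i)) (rank i)); split=> [i ltin|i j /andP[ltij ltjn] eqg].
  by rewrite mem_nth ?rankP.
have ltin := ltn_trans ltij ltjn.
have eqt : ty i = ty j.
  by apply: (@disW _ _ (nth x0 (W (ty i)) (rank i))); last rewrite eqg; rewrite mem_nth ?rankP.
have := rank_lt i j ltij eqt; move: eqg; rewrite eqt => /eqP.
by rewrite nth_uniq ?uW ?rankP -?eqt ?rankP // => /eqP ->; rewrite ltnn.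
Qed.

Section Templates.
Variable R : realType.
Local Notation slot := ((R * R) * R)%type.
Implicit Types (T : seq slot) (sigma : seq R).

Definition template T : Prop :=
  [/\ uniq T, all (@in_unit R) T &
      {in T &, forall a b, a != b -> separated a b}].

(** Each item sits at the lower-left corner of a slot at least as large; shrinking a square towards
    that corner preserves containment and separation. *)
Lemma packing_of_slots sigma (m : nat) (g : nat -> nat * slot) :
  (forall i, (i < size sigma)%N ->
     [/\ ((g i).1 < m)%N, in_unit (g i).2 & 0 < sigma`_i <= (g i).2.2]) ->
  (forall i j, (i < j < size sigma)%N -> (g i).1 = (g j).1 ->
     separated (g i).2 (g j).2) ->
  exists2 p, packing sigma p & (bins_used sigma p <= m)%N.
Proof.
move=> gP gsep; exists (fun i => Placement (g i).1 (g i).2.1).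
  split=> [i lti|i j ltij /= eqb].
    have [_ /and5P[_ ? ? ? ?] /andP[? ?]] := gP i lti.
    move=> z; rewrite /square /= => /andP[/andP[? ?] /andP[? ?]].
    by apply/andP; split; apply/andP; split; lra.
  have lti : (i < size sigma)%N by case/andP: ltij; apply: ltn_trans.
  have ltj : (j < size sigma)%N by case/andP: ltij.
  have [_ _ /andP[? ?]] := gP i lti; have [_ _ /andP[? ?]] := gP j ltj.
  apply: open_square_disjoint; have := gsep i j ltij eqb; rewrite /separated /=.
  by case/or4P => ?; apply/or4P; [apply: Or41|apply: Or42|apply: Or43|apply: Or44]; lra.
rewrite /bins_used -[leqRHS](size_iota 0); apply: uniq_leq_size (undup_uniq _) _ => b.
rewrite mem_undup => /mapP[i]; rewrite mem_iota add0n => /andP[_ lti] ->.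
by have [? _ _] := gP i lti; rewrite mem_iota.
Qed.

(** Bins below [Q] repeat the layout for big items; the next [L] bins repeat the layout with one
    large slot [tl] and the small items. All free slots are filled with sand. *)
Lemma packing_of_templates (med : seq R) (big : pred nat) (Q L : nat) (lg s : R)
    (TB sandB TS sandS : seq slot) (tl : slot) :
  template (TB ++ sandB) -> template (tl :: TS ++ sandS) ->
  all (> 0) med -> 0 < lg <= tl.2 -> 0 < s ->
  {in sandB, forall a, s <= a.2} -> {in sandS, forall a, s <= a.2} ->
  (forall i, (i < size med)%N -> {in if big i then TB else TS, forall a, med`_i <= a.2}) ->
  (count big (iota 0 (size med)) <= Q * size TB)%N ->
  (count (predC big) (iota 0 (size med)) <= L * size TS)%N ->
  exists2 p, packing (med ++ nseq L lg ++ nseq (Q * size sandB + L * size sandS) s) p &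
    (bins_used (med ++ nseq L lg ++ nseq (Q * size sandB + L * size sandS) s) p <= Q + L)%N.
Proof.
move=> [uB inB sepB] [uS inS sepS] med0 /andP[lg0 lgtl] s0 sB sS medP cB cS.
set M := (Q * _ + _)%N; set N := size med; set sigma := med ++ _.
have sz : size sigma = (N + (L + M))%N by rewrite !size_cat !size_nseq.
(* Types: 0 big, 1 small, 2 large, 3 sand. [W] lists the slots reserved for each type. *)
pose ty i : nat := if (i < N)%N then (if big i then 0 else 1)
                   else if (i < N + L)%N then 2 else 3.
pose W (k : nat) : seq (nat * slot) := match k with
  | 0 => [seq (b, a) | b <- iota 0 Q, a <- TB]
  | 1 => [seq (b, a) | b <- iota Q L, a <- TS]
  | 2 => [seq (b, a) | b <- iota Q L, a <- [:: tl]]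
  | 3 => [seq (b, a) | b <- iota 0 Q, a <- sandB] ++ [seq (b, a) | b <- iota Q L, a <- sandS]
  | _ => [::] end.
have memp (bs : seq nat) (T : seq slot) x :
    (x \in [seq (b, a) | b <- bs, a <- T]) = (x.1 \in bs) && (x.2 \in T).
  apply/allpairsP/andP => [[[b a] /= [? ? ->]] //|[? ?]].
  by exists x; split => //; apply: surjective_pairing.
have uall (bs : seq nat) (T : seq slot) : uniq bs -> uniq T -> uniq [seq (b, a) | b <- bs, a <- T].
  by move=> ? ?; apply: allpairs_uniq => // -[? ?] [? ?] _ _ [-> ->].
move: (uB) (uS); rewrite /= mem_cat !cat_uniq negb_or.
move=> /and3P[uTB disB usB] /andP[/andP[tlTS tlsS]] /and3P[uTS disS usS].
have memW k x : x \in W k ->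
    if (x.1 < Q)%N then x.2 \in TB ++ sandB
    else (x.1 < Q + L)%N && (x.2 \in tl :: TS ++ sandS).
  case: k => [|[|[|[|k]]]] //; rewrite /W ?mem_cat !memp !mem_iota ?inE ?mem_cat.
  - by move=> /andP[/andP[_ ->] xT]; rewrite xT.
  - by move=> /andP[/andP[leQ ->] xT]; rewrite ltnNge leQ xT orbT.
  - by move=> /andP[/andP[leQ ->]]; rewrite ltnNge leQ => ->.
  - case/orP=> /andP[/andP[leQ ltQ] xT]; first by rewrite ltQ xT orbT.
    by rewrite ltnNge leQ ltQ xT !orbT.
have W2 x : x \in W 2 -> x.2 = tl by rewrite /W memp inE => /andP[_ /eqP].
have [g [gW ginj]] : exists g : nat -> nat * slot,
    (forall i, (i < size sigma)%N -> g i \in W (ty i)) /\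
    (forall i j, (i < j < size sigma)%N -> g i <> g j).
  apply: (assignment_exists (0%N, tl)).
  - move=> k; rewrite sz iotaD (iotaD _ L M) !count_cat add0n.
    have -> : count (fun i => ty i == k) (iota 0 N) =
        if k == 0 then count big (iota 0 N)
        else if k == 1 then count (predC big) (iota 0 N) else 0.
      case: k => [|[|k]] /=; [| |rewrite -[RHS](count_pred0 (iota 0 N))];
        by apply: eq_in_count => i; rewrite mem_iota add0n /ty => /andP[_ ->] /=; case: (big i).
    have -> : count (fun i => ty i == k) (iota N L) = if k == 2 then L else 0.
      rewrite -[X in if _ then X else _](size_iota N L) -(count_predT (iota N L)).
      rewrite -[X in if _ then _ else X](count_pred0 (iota N L)) -[RHS](fun_if (fun P => count P _)).
      apply: eq_in_count => i; rewrite mem_iota => /andP[leNi lti].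
      by rewrite /ty ltnNge leNi lti eq_sym; case: ifP.
    have -> : count (fun i => ty i == k) (iota (N + L) M) = if k == 3 then M else 0.
      rewrite -[X in if _ then X else _](size_iota (N + L) M) -(count_predT (iota (N + L) M)).
      rewrite -[X in if _ then _ else X](count_pred0 (iota (N + L) M)) -[RHS](fun_if (fun P => count P _)).
      apply: eq_in_count => i; rewrite mem_iota => /andP[lei _].
      by rewrite /ty !ltnNge lei (leq_trans (leq_addr _ _) lei) eq_sym; case: ifP.
    by case: k => [|[|[|[|k]]]]; rewrite /W ?size_cat ?size_allpairs ?size_iota /= ?addn0 ?add0n ?muln1.
  - case=> [|[|[|[|k]]]] //; rewrite /W ?uall ?iota_uniq //.
    rewrite cat_uniq !uall ?iota_uniq // andbT /=; apply/hasPn => x.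
    by rewrite !memp !mem_iota add0n => /andP[/andP[leQ _] _]; rewrite ltnNge leQ.
  (* The type can be read back from the bin number and the slot, so the lists in [W] are
     disjoint. *)
  - pose kind (x : nat * slot) := if (x.1 < Q)%N then (if x.2 \in TB then 0%N else 3)
      else if x.2 == tl then 2 else if x.2 \in TS then 1 else 3.
    suff kindP k x : x \in W k -> k = kind x by move=> k k' x /kindP -> /kindP ->.
    rewrite /kind; case: k => [|[|[|[|k]]]] //; rewrite /W ?mem_cat !memp !mem_iota ?add0n.
    + by move=> /andP[/andP[_ ->] ->].
    + move=> /andP[/andP[leQ _] xT]; rewrite ltnNge leQ xT /=; case: eqP => // xtl.
      by rewrite xtl (negPf tlTS) in xT.
    + by move=> /andP[/andP[leQ _]]; rewrite inE ltnNge leQ => ->.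
    + case/orP=> /andP[/andP[leQ ltQ] xT]; first by rewrite ltQ (negPf (hasPn disB _ xT)).
      rewrite ltnNge leQ (negPf (hasPn disS _ xT)) /=; case: eqP => // xtl.
      by rewrite xtl (negPf tlsS) in xT.
apply: (packing_of_slots (g := g)) => [i lti|i j ltij eqb].
  have gi := gW i lti; have gW' := memW _ _ gi.
  split; first by case: ltnP gW' => [? _|_ /andP[]//]; apply: ltn_addr.
    case: ifP gW' => _; first by apply: (allP inB).
    by case/andP => _; apply: (allP inS).
  move: gi; rewrite /ty /sigma nth_cat -/N; case: ltnP => [ltiN|leNi].
    have := medP i ltiN; rewrite (allP med0) ?mem_nth //=.
    by case: ifP => _ h /=; rewrite memp => /andP[_ /h].
  rewrite nth_cat size_nseq nth_nseq; case: ltnP => [ltL|geL].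
    by rewrite ltn_subLR // ltL lg0 => /W2 ->.
  rewrite ltn_subLR // ltnNge geL /= nth_nseq -subnDA ltn_subLR // -addnA -sz lti s0 /=.
  by rewrite mem_cat !memp => /orP[] /andP[_]; [apply: sB|apply: sS].
have /andP[ltij' ltj] := ltij; have lti := ltn_trans ltij' ltj.
have neg : (g i).2 != (g j).2.
  apply/eqP => eq2; apply: (ginj i j ltij).
  by rewrite [LHS]surjective_pairing eqb eq2 -surjective_pairing.
have := memW _ _ (gW i lti); have := memW _ _ (gW j ltj); rewrite eqb.
case: ifP => _; first by move=> ? ?; apply: sepB.
by move=> /andP[_ ?] /andP[_ ?]; apply: sepS.
Qed.

End Templates.

(** * Filling the free area of a layout with grid cells *)

Section SandTemplates.
Variable R : realType.
Local Notation slot := ((R * R) * R)%type.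
Variable K : nat.
Hypothesis K_gt0 : (0 < K)%N.
Local Notation s := (K%:R^-1 : R).

Definition cell (c : nat * nat) : slot := ((c.1%:R * s, c.2%:R * s), s).

Definition cells : seq (nat * nat) := [seq (i, j) | i <- iota 0 K, j <- iota 0 K].

(* Columns [a, a + w) of the K-by-K grid contain all those meeting (x, x + d). *)
Definition covers (x d : R) (a w : nat) : bool :=
  (a%:R * s <= x) && ((x + d <= (a + w)%:R * s) || (K <= a + w)%N).

Let s_gt0 : 0 < s. Proof. by rewrite invr_gt0 ltr0n. Qed.

Lemma mem_cells c : (c \in cells) = (c.1 < K)%N && (c.2 < K)%N.
Proof.
apply/allpairsP/andP => [[[i j] [/= + + ->]]|[lt1 lt2]]; rewrite ?mem_iota //.
by exists c; rewrite !mem_iota; split=> //; apply: surjective_pairing.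
Qed.

Lemma cells_uniq : uniq cells.
Proof. by apply: allpairs_uniq; rewrite ?iota_uniq // => -[? ?] [? ?] _ _ [-> ->]. Qed.

Lemma covers_mem (x d : R) a w i : covers x d a w -> (i < K)%N ->
  x < i%:R * s + s -> i%:R * s < x + d -> (a <= i < a + w)%N.
Proof.
move=> /andP[ax xd] ltiK h1 h2; apply/andP; split.
  rewrite -ltnS -(ltr_nat R) -(ltr_pM2r s_gt0) -[in ltRHS]natr1 mulrDl mul1r.
  exact: le_lt_trans h1.
case/orP: xd => [xd|]; last exact: leq_trans.
by rewrite -(ltr_nat R) -(ltr_pM2r s_gt0); apply: lt_le_trans xd.
Qed.

(** A cell that is not separated from [b] has its column and its row in the two windows of width
    [w], which leaves at most [w ^ 2] such cells. *)
Lemma count_blocked (b : slot) (x y w : nat) :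
  covers b.1.1 b.2 x w -> covers b.1.2 b.2 y w ->
  (count (fun c => ~~ separated (cell c) b) cells <= w ^ 2)%N.
Proof.
move=> cx cy; rewrite -size_filter -[leqRHS]/(_ * _)%N.
rewrite -{1}(size_iota x w) -{2}(size_iota y w) -(size_allpairs pair).
apply: uniq_leq_size; first by rewrite filter_uniq ?cells_uniq.
move=> c; rewrite mem_filter mem_cells /separated /= !negb_or -!ltNge.
move=> /andP[/and4P[h1 h2 h3 h4] /andP[lt1 lt2]].
rewrite [c]surjective_pairing allpairs_f // mem_iota.
  exact: covers_mem cx lt1 h1 h2.
exact: covers_mem cy lt2 h3 h4.
Qed.

Lemma cell_in_unit c : c \in cells -> in_unit (cell c).
Proof.
rewrite mem_cells => /andP[lt1 lt2].
have up i : (i < K)%N -> i%:R * s + s <= 1.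
  move=> lti; rewrite -[X in _ + X]mul1r -mulrDl natr1 ler_pdivrMr ?ltr0n //.
  by rewrite mul1r ler_nat.
have s0 := ltW s_gt0.
by rewrite /in_unit /= s_gt0 !up ?mulr_ge0 ?ler0n.
Qed.

Lemma cell_inj : injective cell.
Proof.
move=> [i j] [i' j'] [/(mulIf (lt0r_neq0 s_gt0)) /eqP + /(mulIf (lt0r_neq0 s_gt0)) /eqP].
by rewrite !eqr_nat => /eqP -> /eqP ->.
Qed.

Lemma cell_separated c d : c != d -> separated (cell c) (cell d).
Proof.
have lt_sep i j : (i < j)%N -> i%:R * s + s <= j%:R * s.
  by move=> ltij; rewrite -[X in _ + X]mul1r -mulrDl natr1 ler_pM2r // ler_nat.
case: c d => [i j] [i' j'] ned; rewrite /separated /=.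
have [/lt_sep -> //|/lt_sep ->|eqi] := ltngtP i i'; rewrite ?orbT //.
have [/lt_sep ->|/lt_sep ->|eqj] := ltngtP j j'; rewrite ?orbT //.
by rewrite eqi eqj eqxx in ned.
Qed.

(** The sand consists of all cells separated from every square of [T]. A union bound over the
    squares limits the lost cells; [cov] records for each square its first column, first row and
    window width. *)
Lemma template_fill (T : seq slot) (cov : seq (nat * nat * nat)) :
  template T ->
  all2 (fun b c => covers b.1.1 b.2 c.1.1 c.2 && covers b.1.2 b.2 c.1.2 c.2) T cov ->
  exists sand, [/\ template (T ++ sand), {in sand, forall a, a.2 = s} &
    (K ^ 2 <= size sand + sumn [seq c.2 ^ 2 | c <- cov])%N].
Proof.
move=> [uT inT sepT] hcov.
pose free := [seq c <- cells | all (separated (cell c)) T].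
exists [seq cell c | c <- free]; split.
- have mf a : a \in [seq cell c | c <- free] ->
      [/\ in_unit a, all (separated a) T & exists2 c, c \in free & a = cell c].
    move=> /mapP[c cf ->]; have := cf; rewrite mem_filter => /andP[aT cc].
    by split=> //; [apply: cell_in_unit|exists c].
  split.
  + rewrite cat_uniq uT map_inj_uniq ?filter_uniq ?cells_uniq ?andbT //=; last exact: cell_inj.
    apply/hasPn => a /mf[/andP[a0 _] /allP sepa _]; apply/negP => /sepa.
    by rewrite separated_irrefl.
  + by rewrite all_cat inT; apply/allP => a /mf[].
  + move=> a b; rewrite !mem_cat => /orP[aT|/mf[_ /allP sa [c _ ac]]] /orP[bT|/mf[_ /allP sb [d _ bd]]] ne.
    * exact: sepT.
    * by rewrite separatedC sb.
    * exact: sa.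
    * by rewrite ac bd cell_separated //; apply: contra ne; rewrite ac bd => /eqP ->.
- by move=> _ /mapP[c _ ->].
rewrite size_map size_filter {uT inT sepT free}.
elim: T cov hcov => [|b T IH] [|c cov] //= => [_|/andP[/andP[cx cy] /IH{}IH]].
  by rewrite count_predT size_allpairs !size_iota addn0.
apply: leq_trans IH _; rewrite addnA leq_add2r addnC.
apply: leq_trans (leq_add (count_blocked cx cy) (leqnn _)).
set P := fun c => all _ T; rewrite -[leqLHS]addn0.
(* Union bound: every cell free for the tail [T] is either blocked by [b] or free for both. *)
rewrite -(count_predUI (fun c => ~~ separated (cell c) b)) leq_add //.
by apply: sub_count => d /=; case: separated.
Qed.

End SandTemplates.

(** Each unordered pair is checked once, by symmetry. Uniqueness comes along, since a square of
    positive side is not separated from itself. *)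
Lemma template_pairwise (R : realType) (T : seq ((R * R) * R)) :
  all (@in_unit R) T -> pairwise (@separated R) T -> template T.
Proof.
move=> inT; elim: T inT => [|a T IH] //= /andP[a_in inT] /andP[sepa /(IH inT)[uT _ sepT]].
have a_gt0 : 0 < a.2 by case/and5P: a_in.
split; rewrite /= ?a_in ?uT ?andbT //.
  by apply/negP => /(allP sepa); rewrite separated_irrefl.
move=> b c; rewrite !inE => /orP[/eqP ->|bT] /orP[/eqP ->|cT]; first by rewrite eqxx.
- by move=> _; apply: (allP sepa).
- by move=> _; rewrite separatedC; apply: (allP sepa).
- exact: sepT.
Qed.

(** * The three explicit bin layouts *)

Section ConcreteTemplates.
Variables (R : realType) (q : nat).
Hypothesis q_gt0 : (0 < q)%N.
Local Notation K := (6 * q).-1.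
Local Notation s := (K%:R^-1 : R).
Local Notation u := (q%:R * s).

Lemma grid_side_gt0 : 0 < s.
Proof. by rewrite invr_gt0 ltr0n; lia. Qed.

(** The reason for [K = 6 * q - 1]: a block of [q] cells measures slightly more than 1/6, so [2 * u]
    exceeds 1/3 and [3 * u] exceeds 1/2, while [5 * u <= 1] because [s <= u]. *)
Lemma grid_sideE : 6 * u = 1 + s.
Proof.
have K0 : K%:R != 0 :> R by rewrite pnatr_eq0; lia.
have -> : 6 * u = (6 * q)%:R * s by rewrite natrM mulrA.
have -> : (6 * q)%:R = K%:R + 1 :> R by rewrite natr1 prednK // muln_gt0.
by rewrite mulrDl mul1r divff.
Qed.

Lemma grid_side_le : s <= u.
Proof. by rewrite ler_peMl ?(ltW grid_side_gt0) // ler1n. Qed.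

Lemma natr_scale (k : nat) : (k * q)%:R * s = k%:R * u.
Proof. by rewrite natrM mulrA. Qed.

Lemma natr_scale_pred (k : nat) : (0 < k)%N -> (k * q).-1%:R * s = k%:R * u - s.
Proof.
move=> k_gt0; rewrite -natr_scale.
have -> : (k * q)%:R = (k * q).-1%:R + 1 :> R by rewrite natr1 prednK // muln_gt0 k_gt0.
by rewrite mulrDl mul1r addrK.
Qed.

Lemma covers_scale (a w : nat) : covers K (a%:R * u) (w%:R * u) (a * q) (w * q).
Proof. by rewrite /covers -mulnDl !natr_scale natrD mulrDl !lexx. Qed.

Lemma covers_scale0 (d : R) (w : nat) : d <= w%:R * u -> covers K 0 d 0 (w * q).
Proof. by move=> le_d; rewrite /covers mul0r lexx add0r add0n natr_scale le_d. Qed.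

(** The slots use [9 + 3 * 4 = 21] blocks of [q ^ 2] cells out of about 36, leaving 5/12 of the bin
    in the limit. *)
Lemma template_three_medium_half :
  exists sand : seq ((R * R) * R), [/\ template (((0, 0), 3 * u) :: [:: ((3 * u, 0), 2 * u);
        ((0, 3 * u), 2 * u); ((3 * u, 3 * u), 2 * u)] ++ sand),
    {in sand, forall a, a.2 = s} & (K ^ 2 <= size sand + 21 * q ^ 2)%N].
Proof.
have s0 := grid_side_gt0; have us := grid_side_le; have u6 := grid_sideE.
have K_gt0 : (0 < K)%N by lia.
have [] := @template_fill R K K_gt0 [:: ((0, 0), 3 * u); ((3 * u, 0), 2 * u);
   ((0, 3 * u), 2 * u); ((3 * u, 3 * u), 2 * u)]
   [:: (0, 0, 3 * q); (3 * q, 0, 2 * q); (0, 3 * q, 2 * q); (3 * q, 3 * q, 2 * q)]%N.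
- apply: template_pairwise => /=.
    by rewrite /in_unit /= !andbT; repeat (apply/andP; split); lra.
  rewrite /separated /= !andbT; repeat (apply/andP; split); apply/or4P;
    by first [apply: Or41; lra|apply: Or42; lra|apply: Or43; lra|apply: Or44; lra].
- by rewrite /= !covers_scale !covers_scale0.
- by move=> sand [? ? le_sz]; exists sand; split => //; apply: leq_trans le_sz _ => /=; nia.
Qed.

(** Four slots of 4 blocks each use 16 of about 36, leaving 5/9 in the limit. *)
Lemma template_four_medium :
  exists sand : seq ((R * R) * R), [/\ template ([:: ((0, 0), 2 * u); ((2 * u, 0), 2 * u);
        ((0, 2 * u), 2 * u); ((2 * u, 2 * u), 2 * u)] ++ sand),
    {in sand, forall a, a.2 = s} & (K ^ 2 <= size sand + 16 * q ^ 2)%N].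
Proof.
have s0 := grid_side_gt0; have us := grid_side_le; have u6 := grid_sideE.
have K_gt0 : (0 < K)%N by lia.
have [] := @template_fill R K K_gt0 [:: ((0, 0), 2 * u); ((2 * u, 0), 2 * u);
   ((0, 2 * u), 2 * u); ((2 * u, 2 * u), 2 * u)]
   [:: (0, 0, 2 * q); (2 * q, 0, 2 * q); (0, 2 * q, 2 * q); (2 * q, 2 * q, 2 * q)]%N.
- apply: template_pairwise => /=.
    by rewrite /in_unit /= !andbT; repeat (apply/andP; split); lra.
  rewrite /separated /= !andbT; repeat (apply/andP; split); apply/or4P;
    by first [apply: Or41; lra|apply: Or42; lra|apply: Or43; lra|apply: Or44; lra].
- by rewrite /= !covers_scale !covers_scale0.
- by move=> sand [? ? le_sz]; exists sand; split => //; apply: leq_trans le_sz _ => /=; nia.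
Qed.

(** The windows use [16 + 3 * 4 = 28] blocks, leaving 2/9 in the limit. As [t] is not a grid
    coordinate, windows starting at [t] or [1 - t] begin one cell early and run to the edge of the
    grid; [t <= 2 * u] makes this enough for [1 - t]. *)
Lemma template_three_medium_large (t : R) : 3^-1 < t < 2^-1 -> t <= 2 * u ->
  exists sand : seq ((R * R) * R), [/\ template (((t, t), 1 - t) :: [:: ((0, 0), t);
        ((1 - t, 0), t); ((0, 1 - t), t)] ++ sand),
    {in sand, forall a, a.2 = s} & (K ^ 2 <= size sand + 28 * q ^ 2)%N].
Proof.
move=> /andP[t3 t2] tu.
have s0 := grid_side_gt0; have us := grid_side_le; have u6 := grid_sideE.
have K_gt0 : (0 < K)%N by lia.
have [] := @template_fill R K K_gt0 [:: ((t, t), 1 - t); ((0, 0), t); ((1 - t, 0), t);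
   ((0, 1 - t), t)]
   [:: ((2 * q).-1, (2 * q).-1, 4 * q); (0, 0, 2 * q); ((4 * q).-1, 0, 2 * q);
     (0, (4 * q).-1, 2 * q)]%N.
- apply: template_pairwise => /=.
    by rewrite /in_unit /= !andbT; repeat (apply/andP; split); lra.
  rewrite /separated /= !andbT; repeat (apply/andP; split); apply/or4P;
    by first [apply: Or41; lra|apply: Or42; lra|apply: Or43; lra|apply: Or44; lra].
- rewrite /=; have -> : covers K t (1 - t) (2 * q).-1 (4 * q).
    by rewrite /covers natr_scale_pred //; apply/andP; split; [lra|apply/orP; right; lia].
  have -> : covers K (1 - t) t (4 * q).-1 (2 * q).
    by rewrite /covers natr_scale_pred //; apply/andP; split; [lra|apply/orP; right; lia].
  by rewrite covers_scale0.
- by move=> sand [? ? le_sz]; exists sand; split => //; apply: leq_trans le_sz _ => /=; nia.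
Qed.

End ConcreteTemplates.

(** * The two inputs *)

(** The upper limit is an infimum over tails, so some tail has its supremum below [c]. *)
Lemma competitive_ratio_lt (R : realType) (A : online_algorithm R) (c : R) :
  (competitive_ratio A < c%:E)%E ->
  exists n0 : nat, forall sigma n, (n0 <= n)%N -> (0 < n)%N -> input sigma ->
    is_opt sigma n -> (cost A sigma)%:R <= c * n%:R.
Proof.
move=> /ereal_inf_lt[_ [V [n0 _ subV] <-] ltc]; exists n0 => sigma n le_n n_gt0 inp opt.
rewrite -ler_pdivrMr ?ltr0n // -lee_fin; apply: le_trans (ltW ltc).
apply: le_trans (ereal_sup_ubound _); last by exists n; [apply: subV|].
by apply: ereal_sup_ubound; exists sigma.
Qed.

Definition three_phase (R : realType) (med : seq R) (L M : nat) (lg s : R) : seq R :=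
  med ++ nseq L lg ++ nseq M s.

Lemma size_three_phase (R : realType) (med : seq R) L M lg s :
  size (three_phase med L M lg s) = (size med + (L + M))%N.
Proof. by rewrite !size_cat !size_nseq. Qed.

Section Inputs.
Variables (R : realType) (A : online_algorithm R) (y lambda : R).
Hypotheses (y_bounds : 3^-1 < y <= 2^-1) (sandP : B2_sand_separate A y lambda).
Variables (med : seq R).
Hypothesis medium_med : all (medium y) med.
Local Notation N := (size med).

Lemma nth_three_phase L M (lg s : R) i : (i < N + (L + M))%N ->
  (three_phase med L M lg s)`_i =
    if (i < N)%N then med`_i else if (i < N + L)%N then lg else s.
Proof.
move=> lti; rewrite /three_phase !nth_cat size_nseq !nth_nseq; case: ltnP => // leNi.
rewrite (ltn_subLR L leNi); case: ltnP => // le2.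
by rewrite -subnDA ltn_subLR // -addnA lti.
Qed.

Lemma input_three_phase L M (lg s : R) : 0 < lg <= 1 -> 0 < s <= 1 -> input (three_phase med L M lg s).
Proof.
move=> lgP sP; rewrite /input /three_phase !all_cat !all_nseq lgP sP !orbT !andbT.
have /andP[? ?] := y_bounds.
by apply: sub_all medium_med => x /andP[? ?]; apply/andP; split; lra.
Qed.

Lemma medium_nth i : (i < N)%N -> 3^-1 < med`_i <= y.
Proof. by move=> lti; apply: (all_nthP 0 medium_med). Qed.

Lemma count_itv_iota (a b n : nat) : (a + b <= n)%N ->
  (b <= count (fun i => a <= i < a + b)%N (iota 0 n))%N.
Proof.
move=> le_n; rewrite -[leqLHS](size_iota a) -size_filter; apply: uniq_leq_size (iota_uniq _ _) _ => i.
by rewrite mem_filter !mem_iota /= add0n => /andP[-> lti] /=; rewrite lti (leq_trans lti).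
Qed.

(** Three disjoint families of bins are counted: those of the items in [P], one per large item since
    two sides above 1/2 never share a bin, and [z] sand bins with at most [K ^ 2] grains each. *)
Lemma cost_lower_bound (K L M : nat) (lg s : R) (P : pred nat) :
  2^-1 < lg <= 1 -> K.+1%:R^-1 < s <= 1 -> s <= lambda ->
  (forall i j, (i < N)%N -> P i -> (N <= j < N + L)%N ->
     bin_of A (three_phase med L M lg s) i <> bin_of A (three_phase med L M lg s) j) ->
  exists z, (M <= K ^ 2 * z)%N /\
    (bin_count (bin_of A med) N P + L + z <= cost A (three_phase med L M lg s))%N.
Proof.
move=> /andP[lg2 lg1] /andP[sK s1] slam disP; set sigma := three_phase _ _ _ _ _ in disP *.
have s0 : 0 < s by apply: lt_trans sK; rewrite invr_gt0 ltr0n.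
have inp : input sigma by apply: input_three_phase; apply/andP; split => //; lra.
have pk := algP A inp.
have sz : size sigma = (N + (L + M))%N by apply: size_three_phase.
pose f := bin_of A sigma; pose n := size sigma.
pose PA i := (i < N)%N && P i.
pose PB i := (N <= i < N + L)%N.
pose PC i := (N + L <= i < N + L + M)%N.
have sig i : (i < n)%N -> sigma`_i = if (i < N)%N then med`_i else if (i < N + L)%N then lg else s.
  by move=> lti; rewrite nth_three_phase // -sz.
exists (bin_count f n PC); split.
  apply: leq_trans (_ : count PC (iota 0 n) <= _)%N.
    by apply: count_itv_iota; rewrite /n sz addnA.
  apply: (count_bin_le pk (ltn0Sn K)) => i lti /andP[lei _]; rewrite sig //.
  by rewrite !ltnNge lei (leq_trans (leq_addr _ _) lei).
have leL : (L <= bin_count f n PB)%N.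
  apply: leq_trans (_ : count PB (iota 0 n) <= _)%N.
    by apply: count_itv_iota; rewrite /n sz; lia.
  rewrite -[leqRHS]mul1n; apply: (count_bin_le pk (isT : 0 < 2)%N) => i lti /andP[leN ltL].
  by rewrite sig // ltnNge leN ltL.
have leA : (bin_count (bin_of A med) N P <= bin_count f n PA)%N.
  apply: bin_count_le => i lti Pi; exists i; rewrite /PA lti Pi; split => //.
    by rewrite /n sz; lia.
  by rewrite /f /sigma /three_phase bin_of_cat.
(* Condition (2) of the class keeps both the items of [I_m] and the large items out of the sand
   bins. *)
have sand_sep i j : (i < n)%N -> PC i -> (j < N + L)%N -> f i <> f j.
  move=> lti /andP[lei _] ltj eqf.
  have ltjn : (j < n)%N by apply: leq_trans ltj _; rewrite /n sz; lia.
  have [] := sandP inp lti ltjn eqf.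
    by rewrite sig // !ltnNge lei (leq_trans (leq_addr _ _) lei) /= /I_lambda /= s0 slam.
  rewrite sig // ltj; case: ifP => [ltN|_]; last by move=> /(_ lg2).
  by move=> _; apply; apply: medium_nth.
apply: leq_trans (_ : bin_count f n (predU (predU PA PB) PC) <= _)%N; last first.
  rewrite /cost /bins_used -/n -[iota 0 n]filter_predT.
  by apply: (@bin_count_le f n _ f n predT) => i lti _; exists i.
apply: leq_trans (bin_count_disjoint _); last first.
  move=> i j lti ltj Pij PCj eqf; apply: (sand_sep j i ltj PCj) => //.
  by case/orP: Pij => /andP[]; lia.
rewrite leq_add2r; apply: leq_trans (leq_add leA leL) (bin_count_disjoint _).
by move=> i j _ _ /andP[ltN Pi] PBj; apply: disP.
Qed.

(** At most [2 ^ 2] items of side above 1/3 share a bin. Hence the optimum grows with [N], as an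
    asymptotic ratio requires. *)
Lemma opt_lower_bound L M (lg s : R) n : is_opt (three_phase med L M lg s) n -> (N <= 4 * n)%N.
Proof.
move=> [[p pk <-] _]; set sigma := three_phase _ _ _ _ _ in pk *.
have sz : size sigma = (N + (L + M))%N by apply: size_three_phase.
apply: leq_trans (_ : count (fun i => 0 <= i < 0 + N)%N (iota 0 (size sigma)) <= _)%N.
  by apply: count_itv_iota; rewrite sz; lia.
apply: leq_trans (count_bin_le pk (isT : 0 < 3)%N _) _ => [i lti /=|].
  by rewrite add0n => ltN; rewrite nth_three_phase ?ltN -?sz //; case/andP: (medium_nth ltN).
rewrite leq_mul2l /= /bins_used -[iota 0 _ in leqRHS]filter_predT.
by apply: (@bin_count_le _ _ _ _ _ predT) => i lti _; exists i.
Qed.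

Lemma cost_upper_bound (c : R) (n0 L M m : nat) (lg s : R) p :
  (forall sigma n, (n0 <= n)%N -> (0 < n)%N -> input sigma ->
    is_opt sigma n -> (cost A sigma)%:R <= c * n%:R) -> 0 <= c ->
  (4 * n0 < N)%N -> 0 < lg <= 1 -> 0 < s <= 1 ->
  packing (three_phase med L M lg s) p -> (bins_used (three_phase med L M lg s) p <= m)%N ->
  (cost A (three_phase med L M lg s))%:R <= c * m%:R.
Proof.
move=> ratio c0 ltN lgP sP pk le_m.
have [n opt le_n] := is_opt_exists pk.
have leN := opt_lower_bound opt.
have n_gt : (n0 < n)%N by rewrite -(ltn_pmul2l (isT : 0 < 4)%N); apply: leq_trans leN.
apply: le_trans (ratio _ n _ _ (input_three_phase L M lgP sP) opt) _; first exact: ltnW.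
  exact: leq_ltn_trans n_gt.
by rewrite ler_wpM2l // ler_nat (leq_trans le_n).
Qed.

End Inputs.

(** * The inequality that each input imposes on the algorithm's bins *)

Section RatioInequalities.
Variables (R : realType) (A : online_algorithm R) (y lambda c r : R) (n0 q : nat).
Hypotheses (y_bounds : 3^-1 < y <= 2^-1) (sandP : B2_sand_separate A y lambda).
Hypothesis ratio : forall sigma n, (n0 <= n)%N -> (0 < n)%N -> input sigma ->
  is_opt sigma n -> (cost A sigma)%:R <= c * n%:R.
Hypotheses (c_ge0 : 0 <= c) (q_gt0 : (0 < q)%N).
Local Notation K := (6 * q).-1.
Local Notation s := (K%:R^-1 : R).
Local Notation u := (q%:R * s).
Hypotheses (s_lambda : s <= lambda) (le_r : q%:R ^+ 2 <= r * K%:R ^+ 2).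
Variable med : seq R.
Local Notation N := (size med).
Hypotheses (med_bounds : all (fun x => 3^-1 < x <= Num.min y (2 * u)) med)
  (N_gt : (4 * n0 < N)%N).
Local Notation f := (bin_of A med).

Let K_gt0 : (0 < K)%N. Proof. by lia. Qed.

Lemma medium_of_bounds : all (medium y) med.
Proof.
by apply: sub_all med_bounds => x /andP[x3]; rewrite le_min /medium x3 => /andP[].
Qed.

Lemma med_nth i : (i < N)%N -> [/\ 3^-1 < med`_i, med`_i <= y & med`_i <= 2 * u].
Proof.
move=> lti; have /andP[? ] := all_nthP 0 med_bounds i lti.
by rewrite le_min => /andP[].
Qed.

(** Dividing the grain count by [K ^ 2] bounds the sand bins: each bin of the good packing forces a
    share [1 - 16 * r] or [1 - d * r], where [r] bounds the area of a block of [q ^ 2] cells. With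
    its large item, each of the [L] bins accounts for [2 - d * r]. *)
Lemma ratio_inequality (big P : pred nat) (Q L d : nat) (lg : R)
    (TS sandS : seq ((R * R) * R)) (tl : (R * R) * R) :
  template (tl :: TS ++ sandS) -> {in sandS, forall a, a.2 = s} ->
  (K ^ 2 <= size sandS + d * q ^ 2)%N ->
  2^-1 < lg <= 1 -> lg <= tl.2 ->
  (forall i, (i < N)%N -> ~~ big i -> {in TS, forall a, med`_i <= a.2}) ->
  (count big (iota 0 N) <= Q * 4)%N ->
  (count (predC big) (iota 0 N) <= L * size TS)%N ->
  (forall M i j, (i < N)%N -> P i -> (N <= j < N + L)%N ->
     bin_of A (three_phase med L M lg s) i <> bin_of A (three_phase med L M lg s) j) ->
  (bin_count f N P)%:R + L%:R * (2 - d%:R * r) + Q%:R * (1 - 16 * r)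
    <= c * (Q%:R + L%:R).
Proof.
move=> tmS sS szS lgP lgtl smallP cB cS disP.
have s0 : 0 < s := grid_side_gt0 R q_gt0.
have s1 : s <= 1 by rewrite invf_le1 ?ltr0n // ler1n.
have [lg2 lg1] := andP lgP; have lg0 : 0 < lg by lra.
have [sandB [tmB sB szB]] := template_four_medium R q_gt0.
have [||||||||p pk le_p] := packing_of_templates (med := med) (big := big) (Q := Q) (L := L)
    (lg := lg) (s := s) tmB tmS.
- by apply: sub_all med_bounds => x /andP[? _]; lra.
- by rewrite lg0.
- exact: s0.
- by move=> a /sB ->.
- by move=> a /sS ->.
- move=> i lti; case: ifP => [_|/negbT bigi]; last exact: smallP.
  by have [_ _ le_u] := med_nth lti; move=> a; rewrite !inE => /or4P[] /eqP ->.
- exact: cB.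
- exact: cS.
set M := (Q * size sandB + L * size sandS)%N in pk le_p.
have upper := cost_upper_bound y_bounds medium_of_bounds ratio c_ge0 N_gt
  (introT andP (conj lg0 lg1)) (introT andP (conj s0 s1)) pk le_p.
have sK : K.+1%:R^-1 < s <= 1 by rewrite s1 ltf_pV2 ?posrE ?ltr0n // ltr_nat ltnSn.
have [z [leM lower]] := cost_lower_bound y_bounds sandP medium_of_bounds lgP sK s_lambda (disP M).
have {lower upper} le_c : (bin_count f N P)%:R + L%:R + z%:R <= c * (Q%:R + L%:R).
  by rewrite -!natrD; apply: le_trans upper; rewrite ler_nat.
have k0 : 0 < K%:R ^+ 2 :> R by rewrite exprn_gt0 // ltr0n.
have toR (n e : nat) : (K ^ 2 <= n + e * q ^ 2)%N -> K%:R ^+ 2 * (1 - e%:R * r) <= n%:R.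
  rewrite -(ler_nat R) natrD natrM !natrX => h.
  have : e%:R * q%:R ^+ 2 <= e%:R * (r * K%:R ^+ 2) by rewrite ler_wpM2l ?ler0n.
  by lra.
have {leM} : M%:R <= K%:R ^+ 2 * z%:R :> R by rewrite -natrX -natrM ler_nat.
rewrite /M natrD !natrM => leM.
have hB := ler_wpM2l (ler0n R Q) (toR _ _ szB).
have hS := ler_wpM2l (ler0n R L) (toR _ _ szS).
have : K%:R ^+ 2 * (Q%:R * (1 - 16 * r) + L%:R * (1 - d%:R * r)) <= K%:R ^+ 2 * z%:R by lra.
by rewrite ler_pM2l //; lra.
Qed.

Definition in_bin_of_size (k i : nat) : bool := num_medium_in_bin A y med (f i) == k.

Lemma half_input_inequality :
  (bin_count f N (in_bin_of_size 4))%:R + (N %/ 3).+1%:R * (2 - 21 * r)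
    <= c * (N %/ 3).+1%:R.
Proof.
have s0 : 0 < s := grid_side_gt0 R q_gt0.
have u6 : 6 * u = 1 + s := grid_sideE R q_gt0.
have us : s <= u := grid_side_le R q_gt0.
have [sandS [tm sS szS]] := template_three_medium_half R q_gt0.
have lgP : 2^-1 < 3 * u <= 1 by apply/andP; split; lra.
(* No item counts as big here, so [Q = 0] and three items of [I_m] accompany each large one. *)
have := @ratio_inequality pred0 (in_bin_of_size 4) 0 (N %/ 3).+1 21 (3 * u)
  _ _ _ tm sS szS lgP (lexx _).
rewrite mul0r addr0 add0r; apply.
- by move=> i /med_nth[_ _ ?] _ a; rewrite !inE => /or3P[] /eqP ->.
- by rewrite count_pred0.
- by rewrite (eq_count (a2 := predT)) // count_predT size_iota ltnW // ltn_ceil.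
move=> M i j lti Pi /andP[leN ltL] eqb.
set sigma := three_phase _ _ _ _ _ in eqb.
have inp : input sigma.
  apply: (input_three_phase y_bounds medium_of_bounds).
    by apply/andP; split; lra.
  by apply/andP; split; lra.
have sz : size sigma = (N + ((N %/ 3).+1 + M))%N by apply: size_three_phase.
have ltN k : (k < N)%N -> (k < size sigma)%N by rewrite sz; apply: ltn_addr.
have ltj : (j < size sigma)%N by rewrite sz addnA ltn_addr.
pose I := [seq k <- iota 0 N | medium y med`_k && (f k == f i)].
have szI : size I = 4%N by rewrite size_filter; apply/eqP.
(* A large item joining a bin with four items of [I_m] would make five items of side above 1/3 in
   one bin. *)
suff : (size (j :: I) <= 3.-1 ^ 2)%N by rewrite /= szI.
apply: (card_bin_le (b := f i) (algP A inp)) => //.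
  rewrite /= filter_uniq ?iota_uniq // andbT mem_filter mem_iota /= add0n.
  by rewrite ltnNge leN andbF.
have fi : bin_of A sigma i = f i by rewrite /sigma /three_phase bin_of_cat.
move=> k; rewrite inE => /orP[/eqP ->|].
  split=> //; last by rewrite -fi eqb.
  by rewrite (nth_three_phase _ _ (med := med)) -?sz // ltnNge leN ltL /=; lra.
rewrite mem_filter mem_iota add0n => /andP[/andP[medk /eqP fk] /andP[_ ltk]].
split; [exact: ltN| |].
  by rewrite (nth_three_phase _ _ (med := med)) -?sz ?ltN // ltk; case/andP: medk.
by rewrite -fk -[LHS]/(bin_of A sigma k) /sigma /three_phase bin_of_cat.
Qed.

(** Every bin used so far was opened by an item of side above [t], which cannot share a bin with an
    item of side [1 - t]. Hence all [B] bins count in full. *)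
Lemma bisected_input_inequality (t : R) (B : nat) :
  B = bin_count f N predT ->
  3^-1 < t -> t < Num.min y (2 * u) ->
  (forall i, (i < N)%N -> if opens f i then t < med`_i else med`_i <= t) ->
  B%:R + ((N - B) %/ 3).+1%:R * (2 - 28 * r) + (B %/ 4).+1%:R * (1 - 16 * r)
    <= c * ((B %/ 4).+1%:R + ((N - B) %/ 3).+1%:R).
Proof.
move=> eqB t3; rewrite lt_min => /andP[ty tu] medt.
have /andP[y3 y2] := y_bounds.
have s0 : 0 < s := grid_side_gt0 R q_gt0.
have tP : 3^-1 < t < 2^-1 by rewrite t3 (lt_le_trans ty).
have [sandS [tm sS szS]] := template_three_medium_large q_gt0 tP (ltW tu).
have lgP : 2^-1 < 1 - t <= 1 by apply/andP; split; lra.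
rewrite {1}eqB; apply: (ratio_inequality (big := opens f) tm sS szS lgP (lexx _)).
- move=> i lti oi a; have := medt i lti; rewrite (negPf oi) => le_t.
  by rewrite !inE => /or3P[] /eqP ->.
- by rewrite count_opens -eqB ltnW // ltn_ceil.
- have -> : count (predC (opens f)) (iota 0 N) = (N - B)%N.
    have := count_predC (opens f) (iota 0 N).
    by rewrite size_iota count_opens -eqB => /(canRL (addKn _)).
  by rewrite ltnW // ltn_ceil.
move=> M i j lti _ /andP[leN ltL].
set sigma := three_phase _ _ _ _ _.
have inp : input sigma.
  apply: (input_three_phase y_bounds medium_of_bounds).
    by apply/andP; split; lra.
  by rewrite s0 invf_le1 ?ltr0n // ler1n.
have sz : size sigma = (N + (((N - B) %/ 3).+1 + M))%N by apply: size_three_phase.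
have ltj : (j < size sigma)%N by rewrite sz addnA ltn_addr.
have [k [leki ok fk]] := opens_exists f i.
have ltk := leq_ltn_trans leki lti.
have <- : bin_of A sigma k = bin_of A sigma i by rewrite /sigma /three_phase !bin_of_cat.
have ltks : (k < size sigma)%N by rewrite sz ltn_addr.
have sk : sigma`_k = med`_k by rewrite nth_three_phase -?sz // ltk.
have sj : sigma`_j = 1 - t by rewrite nth_three_phase -?sz // ltnNge leN ltL.
have := medt k ltk; rewrite ok => lt_t; have [? _ _] := med_nth ltk.
apply: (bin_neq_of_side (algP A inp)) => //; rewrite ?sk ?sj; [|lra..].
by move=> eqk; move: leN; rewrite -eqk leqNgt ltk.
Qed.

Lemma count_in_bin_of_size (k : nat) :
  (count (in_bin_of_size k) (iota 0 N) <= k * bin_count f N (in_bin_of_size k))%N.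
Proof.
apply: count_le_bin_count => b.
have [numb|numb] := eqVneq (num_medium_in_bin A y med b) k.
  rewrite -[leqRHS]numb -size_filter /num_medium_in_bin /count_items -size_filter.
  apply: uniq_leq_size => [|i]; first by rewrite filter_uniq ?iota_uniq.
  rewrite !mem_filter mem_iota => /andP[/andP[_ ->] /andP[_ lti]].
  by rewrite lti andbT /= andbT; apply: (all_nthP 0 medium_of_bounds).
rewrite (eq_count (a2 := pred0)) ?count_pred0 // => i /=; rewrite /in_bin_of_size.
by case: (f i =P b) => [->|_]; rewrite ?andbF // andbT (negPf numb).
Qed.

Lemma bin_count_in_bin_of_size :
  (bin_count f N (in_bin_of_size 1) + bin_count f N (in_bin_of_size 4) <= bin_count f N predT)%N.
Proof.
apply: leq_trans (bin_count_disjoint _) _; last first.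
  by apply: bin_count_le => i lti _; exists i.
by move=> i j _ _ /eqP P1 /eqP P4 eqf; move: P1; rewrite eqf P4.
Qed.

End RatioInequalities.

(** * Choice of parameters and the numerical contradiction *)

Lemma fine_grid_exists (R : realType) (lambda e : R) : 0 < lambda -> 0 < e ->
  exists q : nat, [/\ (0 < q)%N, (6 * q).-1%:R^-1 <= lambda &
    q%:R ^+ 2 <= (36^-1 + e) * (6 * q).-1%:R ^+ 2].
Proof.
(* The term [lambda^-1] makes the grains small enough. The term [e^-1] gives [e * q > 1], which
   absorbs the linear error in [(6 * q - 1) ^ 2 / 36 = q ^ 2 - q / 3 + 1 / 36]. *)
move=> l0 e0; pose x := lambda^-1 + e^-1 + 1.
have il0 : 0 < lambda^-1 by rewrite invr_gt0.
have ie0 : 0 < e^-1 by rewrite invr_gt0.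
have x0 : 0 <= x by rewrite /x; lra.
have := archi_boundP x0; set q := Num.bound x => ltq.
have q0 : (0 < q)%N by rewrite -(ltr0n R); lra.
have Kq : (6 * q).-1%:R = 6 * q%:R - 1 :> R.
  have -> : (6 : R) * q%:R = (6 * q).-1%:R + 1 by rewrite natr1 prednK ?muln_gt0 // natrM.
  by rewrite addrK.
exists q; split=> //; rewrite Kq.
  rewrite -[leRHS]invrK lef_pV2 ?posrE //; rewrite /x in ltq; lra.
have eq1 : 1 < e * q%:R.
  by rewrite -ltr_pdivrMl // mulr1; rewrite /x in ltq; lra.
have q1 : 1 <= q%:R :> R by rewrite ler1n.
have : q%:R * 1 <= q%:R * (e * q%:R) by rewrite ler_wpM2l // ltW.
have : e * q%:R <= e * q%:R * q%:R by rewrite ler_peMr // ltW; lra.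
by lra.
Qed.

(** In the limit the hypotheses give [B / N] above 0.32126 and below 0.32123. The gap of about
    [4 / 10 ^ 5] pays for [e], for the excess of [r] over 1/36 and for the additive constants. *)
Lemma ratio_contradiction (R : realType) (alpha K1 K2 N B M1 M4 L1 L2 Q : R) :
  let c := 2 + 954 / 10 ^+ 4 in
  let e := (10 ^+ 6)^-1 in
  let r := 36^-1 + (10 ^+ 7)^-1 in
  alpha * N <= M1 + e * N + K1 ->
  (1 - alpha) * N <= 4 * M4 + e * N + K2 ->
  M1 + M4 <= B ->
  M4 + L1 * (2 - 21 * r) <= c * L1 ->
  B + L2 * (2 - 28 * r) + Q * (1 - 16 * r) <= c * (Q + L2) ->
  3 * L1 <= N + 3 -> 3 * L2 <= N - B + 3 -> 4 * Q <= B + 4 ->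
  10 ^+ 6 * (K1 + K2 + 10) < N -> 0 <= K1 -> 0 <= K2 -> False.
Proof. move=> c e r; rewrite /c /e /r; lra. Qed.

Theorem theorem4 (R : realType) (A : online_algorithm R) :
  class_B2 A -> ~ (competitive_ratio A < (2 + 954 / 10 ^+ 4)%:E)%E.
Proof.
move=> [y [lambda [alpha [col [yP lambda0 _ _ [[_ redP] [_ blueP]] sandP _ _ _ _ _]]]]].
move=> /competitive_ratio_lt[n0 ratio].
have e0 : 0 < (10 ^+ 6)^-1 :> R by rewrite invr_gt0 exprn_gt0.
have d0 : 0 < (10 ^+ 7)^-1 :> R by rewrite invr_gt0 exprn_gt0.
have c0 : 0 <= 2 + 954 / 10 ^+ 4 :> R by lra.
have [q [q0 le_lambda le_r]] := fine_grid_exists lambda0 d0.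
have [K1 redK] := redP _ e0; have [K2 blueK] := blueP _ e0.
(* The additive constants may be negative; truncating them at 0 keeps the threshold for [N]
   nonnegative. *)
pose K1' := Num.max K1 0; pose K2' := Num.max K2 0.
have [K1p K2p] : 0 <= K1' /\ 0 <= K2' by rewrite !le_max !lexx !orbT.
(* The first summand makes the additive constants negligible, the second forces the optimum beyond
   [n0]. *)
pose x := 10 ^+ 6 * (K1' + K2' + 10) + 4 * n0%:R.
have x0 : 0 <= x by rewrite addr_ge0 ?mulr_ge0 ?exprn_ge0 ?ler0n //; lra.
have := archi_boundP x0; set N := Num.bound x => ltN.
(* The starting interval of the bisection: its items belong to [I_m] and fit into slots of side
   [2 * u]. *)
have y3 : 3^-1 < Num.min y (2 * (q%:R / (6 * q).-1%:R)).
  rewrite lt_min; have /andP[-> _] := yP.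
  by have := grid_sideE R q0; have := grid_side_gt0 R q0; rewrite /=; lra.
have [med [lo [hi [szN le_lo lt_lohi le_hi medP]]]] := bisecting_adversary A N y3.
have med_bounds : all (fun z => 3^-1 < z <= Num.min y (2 * (q%:R / (6 * q).-1%:R))) med.
  by apply/(all_nthP 0) => i; rewrite szN => /medP[/andP[-> /ltW ->]].
have medium_med := medium_of_bounds med_bounds.
have N_gt : (4 * n0 < size med)%N.
  rewrite szN -(ltr_nat R) natrM; apply: le_lt_trans ltN.
  by rewrite lerDr mulr_ge0 ?exprn_ge0 //; lra.
have inp : input med.
  by have := input_three_phase yP medium_med 0 0 (lg := 1) (s := 1); rewrite /three_phase cats0; apply; rewrite ltr01 lexx.
have numN : num_medium y med = N.
  rewrite -szN /num_medium /count_items -{2}(size_iota 0 (size med)); apply/eqP.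
  by rewrite -all_count; apply/allP => i; rewrite mem_iota => /andP[_]; apply: (all_nthP 0 medium_med).
have := redK med inp I; have := blueK med inp I; rewrite numN => blue red.
pose single := in_bin_of_size A y med 1; pose four := in_bin_of_size A y med 4.
have leM1 : (num_red_1_per_bin A y col med <= bin_count (bin_of A med) (size med) single)%N.
  rewrite -[leqRHS]mul1n; apply: leq_trans (count_in_bin_of_size A med_bounds 1).
  by apply: sub_count => i /andP[_].
have leM4 : (num_blue_4_per_bin A y col med <= 4 * bin_count (bin_of A med) (size med) four)%N.
  apply: leq_trans (count_in_bin_of_size A med_bounds 4).
  by apply: sub_count => i /andP[_].
have leB := bin_count_in_bin_of_size A y med.
have half := half_input_inequality yP sandP ratio c0 q0 le_lambda le_r med_bounds N_gt.
(* The midpoint of the surviving interval separates big from small items strictly. *)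
pose t := (lo + hi) / 2.
have t3 : 3^-1 < t by rewrite /t; lra.
have t_lt : t < Num.min y (2 * (q%:R / (6 * q).-1%:R)) by rewrite /t; lra.
have medt i : (i < size med)%N ->
    if opens (bin_of A med) i then t < med`_i else med`_i <= t.
  by rewrite szN => /medP[_]; case: ifP => _ ?; rewrite /t; lra.
have bis := bisected_input_inequality yP sandP ratio c0 q0 le_lambda le_r med_bounds N_gt
    (erefl _) t3 t_lt medt.
set B := bin_count _ _ predT in leB bis.
(* Taking [n %/ k + 1] bins instead of [n / k] costs only an additive constant. *)
have div_le (k n : nat) : (0 < k)%N -> k%:R * (n %/ k).+1%:R <= n%:R + k%:R :> R.
  by move=> k0; rewrite -natrM -natrD ler_nat mulnS addnC leq_add2r mulnC leq_trunc_div.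
have leBN : (B <= N)%N.
  by rewrite /B -count_opens -szN -{2}(size_iota 0 (size med)) count_size.
apply: (ratio_contradiction (alpha := alpha) (K1 := K1') (K2 := K2') (N := N%:R)
  (M1 := (bin_count (bin_of A med) (size med) single)%:R) _ _ _ half bis) => //.
- apply: le_trans red _; rewrite -!addrA; apply: lerD; first by rewrite ler_nat.
  by rewrite lerD2l le_max lexx.
- apply: le_trans blue _; rewrite -!addrA; apply: lerD; first by rewrite -natrM ler_nat.
  by rewrite lerD2l le_max lexx.
- by rewrite -natrD ler_nat.
- by rewrite szN; apply: div_le.
- by rewrite -natrB // szN; apply: div_le.
- exact: div_le.
- by apply: le_lt_trans ltN; rewrite lerDl mulr_ge0 ?ler0n.
Qed.
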